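(* If $G$ is a subdivision of a simple $3$-connected plane graph $R$ with $\Delta^*(G) \geq 2\chi_c(R) + 2t(G) - 6$, then $\chi_c(G) \leq \lfloor \frac{3}{2}\Delta^*(G)\rfloor$.
   Context: Plane graphs may have multiple edges but no loops; a simple graph has no multiple edges. The degree of a face is the number of vertices incident with it; $\Delta^*(G)$ is the maximum face degree. A subdivision of a graph is obtained by repeatedly replacing an edge $uv$ by a path $u,w,v$ through a new vertex $w$. $t(G)$ denotes the number of vertices of a longest path in $G$ all of whose vertices have degree $2$ (and $t(G)=0$ if there is no vertex of degree 2). A cyclic coloring of a plane graph is a vertex coloring in which any two distinct vertices incident with a common face receive distinct colors; $\chi_c$ denotes the minimum number of colors in a cyclic coloring. *)

(* Defs.v *)
From mathcomp Require Import all_boot.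

Set Implicit Arguments.
Unset Strict Implicit.
Unset Printing Implicit Defensive.

(* A finite loopless multigraph. Each edge is a pair {d, drev d} of opposite
   darts; the dart d runs from src d to src (drev d). *)
Record multigraph := Multigraph {
  vert : finType;
  dart : finType;
  src : dart -> vert;
  drev : dart -> dart;
  drevK : involutive drev;
  no_loop : forall d, src (drev d) != src d
}.

Definition adj (G : multigraph) : rel (vert G) :=
  fun u v => [exists d : dart G, (src d == u) && (src (drev d) == v)].

Definition degree (G : multigraph) (v : vert G) : nat :=
  #|[set d : dart G | src d == v]|.

Definition simple_graph (G : multigraph) : Prop :=
  forall d d' : dart G,
    src d = src d' -> src (drev d) = src (drev d') -> d = d'.

Definition k_connected (k : nat) (G : multigraph) : Prop :=
  k < #|vert G| /\
  forall S : {set vert G}, #|S| < k ->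
  forall u v : vert G, u \notin S -> v \notin S ->
    connect [rel x y | adj x y && (y \notin S)] u v.

(* The value is 0 when there is no vertex of degree 2, as the empty tuple
   qualifies for n = 0. *)
Definition t_num (G : multigraph) : nat :=
  \max_(n < #|vert G|.+1 |
        [exists s : n.-tuple (vert G),
          [&& uniq s, sorted (@adj G) s & all (fun v => degree v == 2) s]]) n.

(* A connected plane graph with at least one edge, given as a combinatorial map:
   drot is the cyclic order of the darts around each vertex, the faces are the
   orbits of drot \o drev, and the embedding is in the plane by Euler's formula
   #V + #F = #E + 2. The formula and connectedness together exclude graphs
   without edges, so every vertex is the source of some dart. *)
Record plane_graph := PlaneGraph {
  graph_of :> multigraph;
  drot : dart graph_of -> dart graph_of;
  drot_inj : injective drot;
  drot_orbit : forall d d', fconnect drot d d' = (src d == src d');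
  plane_connected : forall u v : vert graph_of, connect (@adj graph_of) u v;
  euler_formula :
    #|vert graph_of| + fcard (fun d => drot (drev d)) (dart graph_of)
      = #|dart graph_of|./2 + 2
}.

Definition face_next (G : plane_graph) (d : dart G) : dart G := drot (drev d).

(* The vertices incident with the face whose boundary contains the dart d. As d
   ranges over all darts, this ranges over all faces. *)
Definition face_verts (G : plane_graph) (d : dart G) : {set vert G} :=
  [set src d' | d' in fconnect (@face_next G) d].

(* Vertices are counted without repetition along the boundary walk. *)
Definition face_degree (G : plane_graph) (d : dart G) : nat := #|face_verts d|.

Definition max_face_degree (G : plane_graph) : nat :=
  \max_(d : dart G) face_degree d.

Definition cyclic_coloring (G : plane_graph) (k : nat)
    (c : {ffun vert G -> 'I_k}) : bool :=
  [forall d : dart G, forall u in face_verts d, forall v in face_verts d,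
     (u != v) ==> (c u != c v)].

Definition cyclic_colorable (G : plane_graph) (k : nat) : bool :=
  [exists c : {ffun vert G -> 'I_k}, cyclic_coloring c].

Lemma ex_cyclic_colorable (G : plane_graph) : exists k, cyclic_colorable G k.
Proof.
exists #|vert G|; apply/existsP; exists [ffun v => enum_rank v].
apply/forallP=> d; apply/forall_inP=> u _; apply/forall_inP=> v _.
by apply/implyP; apply: contra; rewrite !ffunE => /eqP /enum_rank_inj ->.
Qed.

Definition chi_c (G : plane_graph) : nat := ex_minn (ex_cyclic_colorable G).

(* H arises from G, up to renaming by fV and fD, by putting a new vertex
   w = fV None on the edge {e, drev e}. The darts e and drev e keep their sources
   and their places in the rotation and now end at w; the two new darts
   fD (inr false) and fD (inr true) at w are their respective reverses. *)
Definition subdivides_edge (G H : plane_graph) : Prop :=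
  exists (e : dart G) (fV : option (vert G) -> vert H)
         (fD : dart G + bool -> dart H),
  [/\ bijective fV, bijective fD,
      (forall d, src (fD (inl d)) = fV (Some (src d))) /\
      (forall b, src (fD (inr b)) = fV None),
      forall d, drev (fD (inl d)) =
        if d == e then fD (inr false)
        else if d == drev e then fD (inr true)
        else fD (inl (drev d))
    & (forall d, drot (fD (inl d)) = fD (inl (drot d))) /\
      (forall b, drot (fD (inr b)) = fD (inr (~~ b)))].

Inductive subdivision (R : plane_graph) : plane_graph -> Prop :=
| subdivision_refl : subdivision R R
| subdivision_step G H :
    subdivision R G -> subdivides_edge G H -> subdivision R H.

(* Main.v *)
Require Import Defs.
From mathcomp Require Import all_boot fingroup perm zify.

Set Implicit Arguments.
Unset Strict Implicit.
Unset Printing Implicit Defensive.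

(* Color the vertices of [R] in [G] with [chi_c R] colors. The remaining vertices
   have degree 2, and each lies on exactly two faces; view it as an edge joining
   these two faces. Since [R] is 3-connected, two faces share at most one edge of
   [R], so the resulting multigraph has multiplicity at most [t_num G], and as
   every face has at least 3 vertices of [R], its maximum degree is at most
   [max_face_degree G - 3]. Vizing's theorem for multigraphs colors it with
   [max_face_degree G - 3 + t_num G] further colors.

   That two faces share at most one edge is read off Euler's formula: deleting two
   edges with the same pair of faces leaves the number of faces unchanged, hence
   disconnects the graph by the genus inequality, giving a 2-edge cut. *)

(** * Vizing's theorem for multigraphs *)

Lemma sub_path_target (T : eqType) (r r' : rel T) (x : T) (p : seq T) :
  (forall y z, z \in p -> r y z -> r' y z) -> path r x p -> path r' x p.
Proof.
elim: p x => //= z p IHp x sub /andP[/sub -> /=]; last by rewrite mem_head.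
by apply: IHp => y w wp; apply: sub; rewrite inE wp orbT.
Qed.

(* The component of a fixed point of [B] under two involutions [A] and [B] is its
   orbit under [A \o B]. *)
Section TwoInvolutions.

Variables (T : finType) (A B : T -> T) (x : T).
Hypotheses (AK : involutive A) (BK : involutive B) (Bx : B x = x).

Let s := A \o B.

Let s_inj : injective s.
Proof. exact: inj_comp (inv_inj AK) (inv_inj BK). Qed.

(** Conjugation by [B] inverts [s], and [B] fixes [x], so [B] sends the [i]-th iterate of [s] at [x]
    to the [-i]-th one. *)
Let iterB i : iter i s (B (iter i s x)) = x.
Proof.
by elim: i => [//|i IHi]; rewrite iterSr iterS /s /= BK AK.
Qed.

Lemma fconnect_invB v : fconnect s x v -> fconnect s x (B v).
Proof.
move=> /iter_findex <-; rewrite (fconnect_sym s_inj).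
rewrite -[X in fconnect _ _ X](iterB (findex s x v)).
exact: fconnect_iter.
Qed.

Lemma fconnect_invA v : fconnect s x v -> fconnect s x (A v).
Proof.
move=> /fconnect_invB xv; apply: connect_trans xv _.
by rewrite -{2}(BK v) -[A _]/(s (B v)) fconnect1.
Qed.

(** An alternating path that starts at [x] has only one other end. If [A] fixes the iterate of index
    [i], then [2i] steps from [x] amount to one step, hence [2ij] steps amount to [j]. For two such
    indices [i] and [j], [2ij] steps amount both to [j] and to [i]. *)
Lemma fconnect_fixA_unique y z :
  fconnect s x y -> fconnect s x z -> A y = y -> A z = z -> y = z.
Proof.
have halfstep i : A (iter i s x) = iter i s x -> iter (i + i) s x = s x.
  move=> fixA; rewrite iterD -{}fixA -{1}(BK (iter i s x)) -[A _]/(s (B _)).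
  by rewrite -iterSr iterS iterB.
have mulstep i j : A (iter i s x) = iter i s x -> iter ((i + i) * j) s x = iter j s x.
  move/halfstep=> fixA; elim: j => [|j IHj]; first by rewrite muln0.
  by rewrite mulnS addnC iterD fixA -iterSr iterS IHj.
move=> /iter_findex <- /iter_findex <-; set i := findex _ _ y; set j := findex _ _ z.
move=> /mulstep fi /mulstep fj; rewrite -(fi j) -(fj i); congr (iter _ s x); lia.
Qed.

End TwoInvolutions.

Section EdgeColoring.

Variables (E F K : finType) (a b : E -> F).
Hypothesis ab_neq : forall e, a e != b e.

Definition inc (e : E) (v : F) := (a e == v) || (b e == v).
Definition other (e : E) (v : F) := if a e == v then b e else a e.

Implicit Types (c : {ffun E -> option K}).

Definition proper c := [forall e, forall e', forall v,
  [&& inc e v, inc e' v, c e == c e' & c e] ==> (e == e')].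

Lemma properP c : reflect
  (forall e e' v k, inc e v -> inc e' v -> c e = Some k -> c e' = Some k -> e = e')
  (proper c).
Proof.
apply: (iffP forallP) => [H e e' v k ev e'v ce ce'|H e].
  have /forallP/(_ e')/forallP/(_ v) := H e.
  by rewrite ev e'v ce ce' eqxx => /eqP.
apply/forallP=> e'; apply/forallP=> v; apply/implyP=> /and4P[ev e'v /eqP].
case ce': (c e') => [k|] ce; last by rewrite ce.
by move=> _; apply/eqP; apply: (H e e' v k).
Qed.

Definition free c (v : F) (k : K) := [forall e, inc e v ==> (c e != Some k)].

Lemma freeP c v k : reflect (forall e, inc e v -> c e <> Some k) (free c v k).
Proof.
by apply: (iffP forallP) => H e; [move=> ev; have := H e; rewrite ev => /eqP
  | apply/implyP=> /H /eqP].
Qed.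

Definition uncolored c := #|[set e | c e == None]|.

Definition upd c e0 o : {ffun E -> option K} := [ffun e => if e == e0 then o else c e].

Lemma upd_same c e0 o : upd c e0 o e0 = o.
Proof. by rewrite ffunE eqxx. Qed.

Lemma upd_neq c e0 o e : e != e0 -> upd c e0 o e = c e.
Proof. by rewrite ffunE => /negPf ->. Qed.

Lemma proper_erase c e0 : proper c -> proper (upd c e0 None).
Proof.
move=> /properP cP; apply/properP=> e e' v k ev e'v; rewrite !ffunE.
by case: ifP => // _; case: ifP => // _; apply: cP ev e'v.
Qed.

Lemma proper_add c e0 k :
  proper c -> (forall v, inc e0 v -> free c v k) -> proper (upd c e0 (Some k)).
Proof.
move=> /properP cP fr; apply/properP=> e e' v k' ev e'v; rewrite !ffunE.
case: (eqVneq e e0) => [ee0|_]; case: (eqVneq e' e0) => [e'e0|_].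
- by rewrite ee0 e'e0.
- move=> [<-] ce'; subst e; by have /freeP/(_ e' e'v) := fr v ev.
- move=> ce [kE]; subst e' k'; by have /freeP/(_ e ev) := fr v e'v.
- exact: cP ev e'v.
Qed.

Lemma uncolored_add c e0 k :
  c e0 = None -> uncolored c = (uncolored (upd c e0 (Some k))).+1.
Proof.
move=> ce0; rewrite /uncolored (cardsD1 e0) inE ce0 eqxx add1n; congr _.+1.
by apply: eq_card => e; rewrite !inE ffunE; case: (e == e0).
Qed.

Lemma uncolored_erase c e0 k :
  c e0 = Some k -> uncolored (upd c e0 None) = (uncolored c).+1.
Proof.
move=> ce0; rewrite (@uncolored_add _ e0 k) ?upd_same //; congr (uncolored _).+1.
by apply/ffunP=> e; rewrite !ffunE; case: eqP => // ->.
Qed.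

Lemma inc_other e v w : inc e v -> inc e w -> w = v \/ w = other e v.
Proof.
rewrite /inc /other => /orP[] /eqP <- /orP[] /eqP <-; rewrite ?eqxx;
  [by left|by right| |by left].
by rewrite (negPf (ab_neq e)); right.
Qed.

Lemma other_inc e v : inc e v -> inc e (other e v).
Proof. by rewrite /inc /other; case: ifP => _; rewrite eqxx ?orbT. Qed.

Lemma other_neq e v : inc e v -> other e v != v.
Proof.
by rewrite /inc /other; case: (eqVneq (a e) v) => [<- _|//]; rewrite eq_sym.
Qed.

Lemma otherK e v : inc e v -> other e (other e v) = v.
Proof.
move=> ev; have ov := other_inc ev.
have [//|vE] := inc_other ov ev; first by move=> vE; have := other_neq ev; rewrite -vE eqxx.
by [].
Qed.

Definition improvable c := exists c', proper c' /\ uncolored c' < uncolored c.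

(* Edges at [x] in this relation are consecutive in a fan: shifting the color of
   the second one to the first one keeps the coloring proper. *)
Definition fan_step c (x : F) : rel E := fun e e' =>
  inc e' x && (if c e' is Some k then free c (other e x) k else false).

(** Shift colors along the fan: [e0] takes the color of [e1], and [e1] becomes the uncolored edge
    from which the shorter fan starts. At the last edge, [k] is free at both ends. *)
Lemma fan_path_improvable c x e0 p k :
    proper c -> c e0 = None -> inc e0 x -> uniq (e0 :: p) ->
    path (fan_step c x) e0 p -> free c x k -> free c (other (last e0 p) x) k ->
  improvable c.
Proof.
elim: p c e0 => [|e1 p IHp] c e0 cP ce0 e0x.
  move=> _ _ fx fy; exists (upd c e0 (Some k)); split; last by rewrite (uncolored_add k ce0).
  by apply: proper_add => // v /(inc_other e0x)[] ->.
rewrite [path _ _ _]/= [last _ _]/= cons_uniq => /andP[].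
rewrite inE negb_or => /andP[n01 e0p] Up.
rewrite {1}/fan_step; case/andP=> /andP[e1x]; case ce1: (c e1) => [k1|//] f01 pth fx fy.
have /properP cPP := cP.
pose c1 := upd c e1 None; have c1P : proper c1 by apply: proper_erase.
have c1e0 : c1 e0 = None by rewrite upd_neq.
have fr1 v k' : free c v k' -> free c1 v k'.
  move/freeP=> f; apply/freeP=> e ev; rewrite ffunE; case: ifP => // _; exact: f.
have fr1x : free c1 x k1.
  apply/freeP=> e ex; rewrite ffunE; case: eqP => // ne ce; case: ne.
  exact: cPP ex e1x ce ce1.
pose c2 := upd c1 e0 (Some k1).
have c2P : proper c2 by apply: proper_add => // v /(inc_other e0x)[] -> //; apply: fr1.
have fr2 v k' : k' != k1 -> free c v k' -> free c2 v k'.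
  move=> nk /fr1/freeP f; apply/freeP=> e ev; rewrite ffunE; case: ifP => _; last exact: f.
  by move=> [kE]; rewrite kE eqxx in nk.
(* Recoloring [e0] can only destroy the freeness of [k1]; the later fan edges carry other colors at
   [x], so their steps survive. *)
have at_x k' e : inc e x -> e != e1 -> c e = Some k' -> k' != k1.
  move=> ex ne ce; apply: contraNneq ne => kE; rewrite kE in ce.
  by apply/eqP; apply: cPP ex e1x ce ce1.
have unc : uncolored c2 = uncolored c.
  by apply: succn_inj; rewrite -(uncolored_add k1 c1e0) (uncolored_erase ce1).
have nk : k != k1 by apply: contraL fx => /eqP ->; apply/negP=> /freeP/(_ e1 e1x).
suff [c' [c'P lt]] : improvable c2 by exists c'; rewrite -unc.
apply: (IHp c2 e1) => //; try exact: fr2.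
  by rewrite upd_neq ?upd_same // eq_sym.
apply: sub_path_target pth => e e2 e2p /andP[e2x]; rewrite /fan_step e2x /=.
have n2 : e2 != e0 by apply: contraNneq e0p => <-.
have n1 : e2 != e1 by case/andP: Up => e1p _; apply: contraNneq e1p => <-.
rewrite !upd_neq //; case ce2: (c e2) => [k2|//]; apply: fr2.
exact: at_x e2x n1 ce2.
Qed.

Lemma fan_improvable c x e0 e k :
    proper c -> c e0 = None -> inc e0 x -> connect (fan_step c x) e0 e ->
    free c x k -> free c (other e x) k ->
  improvable c.
Proof.
move=> cP ce0 e0x /connectP[p pth ->]; case/shortenP: pth => p' pth' Up' _.
exact: fan_path_improvable.
Qed.

(** A vertex without an edge of color [k] is its own mate. This makes [mate c k] an involution whose
    fixed points are the vertices where [k] is free, so two colors give two involutions. *)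
Definition mate c k v :=
  if [pick e | inc e v && (c e == Some k)] is Some e then other e v else v.

Lemma mate_edge c k e v : proper c -> inc e v -> c e = Some k -> mate c k v = other e v.
Proof.
move=> /properP cP ev ce; rewrite /mate; case: pickP => [e' /andP[e'v /eqP ce']|/(_ e)].
  by rewrite (cP _ _ _ _ e'v ev ce' ce).
by rewrite ev ce eqxx.
Qed.

Lemma mate_free c k v : free c v k -> mate c k v = v.
Proof.
move/freeP=> f; rewrite /mate; case: pickP => // e /andP[ev /eqP ce].
by case: (f e ev).
Qed.

Lemma mateK c k : proper c -> involutive (mate c k).
Proof.
move=> cP v; rewrite {2}/mate; case: pickP => [e /andP[ev /eqP ce]|none].
  by rewrite (mate_edge cP (other_inc ev) ce) otherK.
rewrite mate_free //; apply/freeP=> e ev ce.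
by have := none e; rewrite ev ce eqxx.
Qed.

(** [C] is the component of [x] in the subgraph of colors [k1] and [k2]. It is a path with end [x],
    since [k2] is free there; if it contained both [y] and [z], the mate map of [k1] would have two
    fixed points on it. *)
Lemma kempe_component c x y z k1 k2 :
    proper c -> free c x k2 -> free c y k1 -> free c z k1 -> y != z ->
  exists C : {set F}, [/\ x \in C, ~~ ((y \in C) && (z \in C)) &
    forall e, c e = Some k1 \/ c e = Some k2 -> (a e \in C) = (b e \in C)].
Proof.
move=> cP fx fy fz nyz; pose s := mate c k1 \o mate c k2.
have fixx := mate_free fx; have K1 := mateK k1 cP; have K2 := mateK k2 cP.
exists [set v | fconnect s x v]; split=> [||e cE]; rewrite ?inE ?connect0 //.
  apply: contra nyz => /andP[xy xz]; apply/eqP.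
  by apply: fconnect_fixA_unique xy xz _ _; rewrite ?mate_free.
have ea : inc e (a e) by rewrite /inc eqxx.
have eb : inc e (b e) by rewrite /inc eqxx orbT.
have oa : other e (a e) = b e by rewrite /other eqxx.
have ob : other e (b e) = a e by rewrite /other (negPf (ab_neq e)).
case: cE => ce.
  by apply/idP/idP => /(fconnect_invA K1 K2 fixx);
    rewrite (mate_edge cP _ ce) // ?oa ?ob.
by apply/idP/idP => /(fconnect_invB K1 K2 fixx);
  rewrite (mate_edge cP _ ce) // ?oa ?ob.
Qed.

Section Kempe.

Variables (c : {ffun E -> option K}) (k1 k2 : K) (C : {set F}).
Hypothesis C_closed :
  forall e, c e = Some k1 \/ c e = Some k2 -> (a e \in C) = (b e \in C).

(** The swap is done outside [C], so that colors at vertices of [C] stay. Testing only the end [a e]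
    is harmless: edges of the two colors have both ends on the same side, and other colors are fixed
    by the transposition. *)
Definition kempe_swap : {ffun E -> option K} :=
  [ffun e => if a e \in C then c e else omap (tperm k1 k2) (c e)].

Lemma kempe_swapE e v : inc e v ->
  kempe_swap e = if v \in C then c e else omap (tperm k1 k2) (c e).
Proof.
rewrite ffunE => /orP[] /eqP <- //; case ce: (c e) => [k|]; last by rewrite !if_same.
have [kE|n1] := eqVneq k k1; first by rewrite C_closed // ce kE; left.
have [kE|n2] := eqVneq k k2; first by rewrite C_closed // ce kE; right.
by rewrite /= tpermD 1?eq_sym // !if_same.
Qed.

Lemma kempe_swap_free v k :
  free kempe_swap v k = free c v (if v \in C then k else tperm k1 k2 k).
Proof.
apply: eq_forallb => e; case ev: (inc e v) => //=; rewrite (kempe_swapE ev).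
case: ifP => // _; case: (c e) => [k'|] //=; congr (~~ _).
apply/eqP/eqP => -[]; first by move <-; rewrite tpermK.
by move=> ->; rewrite tpermK.
Qed.

Lemma kempe_swap_proper : proper c -> proper kempe_swap.
Proof.
move=> /properP cP; apply/properP=> e e' v k ev e'v.
rewrite (kempe_swapE ev) (kempe_swapE e'v); case: ifP => _; first exact: (cP _ _ _ _ ev e'v).
case ce: (c e) => [k'|] //= [kE]; case ce': (c e') => [k''|] //= [kE'].
apply: (cP _ _ _ _ ev e'v ce); rewrite ce'; congr Some.
by apply: (@perm_inj _ (tperm k1 k2)); rewrite kE.
Qed.

Lemma kempe_swap_uncolored : uncolored kempe_swap = uncolored c.
Proof.
apply: eq_card => e; rewrite !inE ffunE; case: ifP => // _.
by case: (c e).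
Qed.

End Kempe.

(** Stop at the first fan edge whose end has [k] free. A step onto an edge of color [k] requires [k]
    to be free at the end before it, so no such step occurs earlier. *)
Lemma fan_first_free c x e0 e k :
    connect (fan_step c x) e0 e -> free c (other e x) k ->
  exists2 e1, connect [rel e e' | fan_step c x e e' && (c e' != Some k)] e0 e1
    & free c (other e1 x) k.
Proof.
case/connectP=> p; elim: p e0 => [|w p IHp] e0 /=.
  by move=> _ -> fe; exists e0; rewrite ?connect0.
case/andP=> stp pth lastE fe.
case f0: (free c (other e0 x) k); first by exists e0.
have [e1 conn f1] := IHp w pth lastE fe; exists e1 => //.
apply: connect_trans (connect1 _) conn; rewrite /= stp /=.
case/andP: stp => _; case: (c w) => [k'|//] fk'.
by apply: contraTneq fk' => -[->]; rewrite f0.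
Qed.

(* Otherwise a Kempe swap away from the component of [x] keeps the fan and makes
   [k2] free at one of its ends, without affecting [x]. *)
Lemma fan_ends_unique c x e0 e e' k k2 :
    proper c -> ~ improvable c -> c e0 = None -> inc e0 x -> free c x k2 ->
    connect (fan_step c x) e0 e -> connect (fan_step c x) e0 e' ->
    free c (other e x) k -> free c (other e' x) k ->
  other e x = other e' x.
Proof.
move=> cP nimp ce0 e0x fx2 conn conn' fe fe'.
have [//|neq] := eqVneq (other e x) (other e' x).
have nfx : ~ free c x k by move=> fx; apply: nimp; apply: (fan_improvable _ _ _ conn fx fe).
have nk : k != k2 by apply/eqP=> kE; rewrite kE in nfx.
(* The fan up to [e1] avoids color [k]; [e2] is whichever of [e] and [e'] has an end different from
   that of [e1]. *)
have [e1 conn1 f1] := fan_first_free conn fe.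
have [e2 conn2 [f2 n12]] : exists2 e2, connect (fan_step c x) e0 e2 &
    free c (other e2 x) k /\ other e1 x != other e2 x.
  have [oE|] := eqVneq (other e1 x) (other e x); last by exists e.
  by exists e' => //; rewrite oE.
have [C [xC y12 closedC]] := kempe_component cP fx2 f1 f2 n12.
pose c' := kempe_swap c k k2 C.
have c'P : proper c' by apply: kempe_swap_proper.
have c'x w : inc w x -> c' w = c w by move=> wx; rewrite /c' (kempe_swapE closedC wx) xC.
have c'e0 : c' e0 = None by rewrite c'x.
have fx2' : free c' x k2 by rewrite (kempe_swap_free closedC) xC.
(* The color of [w] is not [k2] either, as [k2] is free at [x], so the swap does not touch it. *)
have step' z w : fan_step c x z w -> c w != Some k -> fan_step c' x z w.
  rewrite /fan_step => /andP[wx]; rewrite wx c'x //=; case cw: (c w) => [k'|//] fk' nk'.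
  rewrite (kempe_swap_free closedC); case: ifP => // _.
  rewrite tpermD //; first by apply: contraNneq nk' => ->.
  by apply/eqP=> kE; move/freeP: fx2 => /(_ w wx); rewrite cw kE.
have conn1' : connect (fan_step c' x) e0 e1.
  by apply: connect_sub conn1 => z w /= /andP[s1 s2]; apply/connect1/step'.
have imp' : improvable c' -> False.
  case=> c2 [c2P lt]; apply: nimp; exists c2; split=> //.
  by rewrite -(kempe_swap_uncolored c k k2 C).
(* At an end outside [C], the swap turns the free color [k] into the free color [k2], which is also
   free at [x]. If the end of [e1] lies in [C], then that of [e2] does not. *)
exfalso; apply: imp'; have [y1C|y1C] := boolP (other e1 x \in C); last first.
  apply: (fan_improvable c'P c'e0 e0x conn1' fx2').
  by rewrite (kempe_swap_free closedC) (negPf y1C) tpermR.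
rewrite y1C /= in y12.
have conn2' : connect (fan_step c' x) e0 e2.
  have f1' : free c' (other e1 x) k by rewrite (kempe_swap_free closedC) y1C.
  (* The swap can break only steps onto an edge of color [k]; such an edge is reached from [e1]
     instead, at whose end [k] is still free. *)
  have ext p z : path (fan_step c x) z p -> connect (fan_step c' x) e0 z ->
      connect (fan_step c' x) e0 (last z p).
    elim: p z => //= w p IHp z /andP[stp pth] cz; apply: IHp pth _.
    have [cw|nw] := eqVneq (c w) (Some k); last first.
      exact: connect_trans cz (connect1 (step' _ _ stp nw)).
    apply: connect_trans conn1' (connect1 _); case/andP: stp => wx _.
    by rewrite /fan_step wx c'x // cw.
  by case/connectP: conn2 => p pth ->; apply: ext pth (connect0 _ _).
apply: (fan_improvable c'P c'e0 e0x conn2' fx2').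
by rewrite (kempe_swap_free closedC) (negPf y12) tpermR.
Qed.

Variables D mu : nat.
Hypothesis deg_le : forall v, #|[set e | inc e v]| <= D.
Hypothesis mult_le : forall u v, u != v -> #|[set e | inc e u && inc e v]| <= mu.
Hypothesis card_colors : #|K| = D + mu.

Lemma card_free_ge c v : mu <= #|[set k | free c v k]|.
Proof.
have := cardsC [set k | free c v k]; rewrite card_colors.
suff : #|~: [set k | free c v k]| <= D by lia.
apply: leq_trans (deg_le v).
have Some_injK : injective (@Some K) by move=> ? ? [].
rewrite -(card_imset _ Some_injK); apply: leq_trans (leq_imset_card c _).
apply/subset_leq_card/subsetP=> _ /imsetP[k kN ->]; move: kN; rewrite !inE.
rewrite negb_forall => /existsP[e]; rewrite negb_imply negbK => /andP[ev /eqP ce].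
by apply/imsetP; exists e; rewrite ?inE.
Qed.

(* The fan [S] at [x] reaches at most [mu] edges per end, but each of its ends
   has at least [mu] free colors; these are pairwise distinct and occur at [x] on
   edges of [S] other than [e0]. *)
Lemma uncolored_improvable c e0 :
  proper c -> c e0 = None -> ~ improvable c -> False.
Proof.
move=> cP ce0 nimp; pose x := a e0; have e0x : inc e0 x by rewrite /inc eqxx.
have mu_gt0 : 0 < mu.
  apply: leq_trans (mult_le (ab_neq e0)); rewrite card_gt0; apply/set0Pn; exists e0.
  by rewrite inE /inc !eqxx orbT.
have [k2 fx2] : exists k2, free c x k2.
  have /set0Pn[k2] : [set k | free c x k] != set0.
    by rewrite -card_gt0; apply: leq_trans (card_free_ge c x).
  by rewrite inE; exists k2.
pose S := [set e | connect (fan_step c x) e0 e].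
have Sx e : e \in S -> inc e x.
  rewrite inE => /connectP[p pth ->]; case/lastP: p pth => //= p w.
  by rewrite rcons_path last_rcons => /andP[_ /andP[]].
pose h e := other e x; pose Y := h @: S.
have leS : #|S| <= #|Y| * mu.
  rewrite -sum1_card (partition_big_imset h) /= -sum_nat_const; apply: leq_sum => y.
  case/imsetP=> e1 e1S yE; rewrite sum1_card.
  have nxy : x != y by rewrite yE eq_sym other_neq ?Sx.
  apply: leq_trans (mult_le nxy); apply/subset_leq_card/subsetP=> e.
  rewrite -topredE /= => /andP[eS /eqP <-]; by rewrite inE Sx ?other_inc ?Sx.
pose T := [set q : F * K | (q.1 \in Y) && free c q.1 q.2].
have geT : #|Y| * mu <= #|T|.
  have -> : #|T| = \sum_(y in Y) #|[set k | free c y k]|.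
    rewrite -sum1_card (eq_bigl _ _ (in_set _)) -(pair_big_dep _ _ (fun _ _ => 1)) /=.
    by apply: eq_bigr => y _; rewrite sum1dep_card.
  by rewrite -sum_nat_const; apply: leq_sum => y _; apply: card_free_ge.
have snd_inj : {in T &, injective (fun q : F * K => Some q.2)}.
  move=> [y k] [y' k']; rewrite !inE /=.
  case/andP=> /imsetP[e eS ->] f /andP[/imsetP[e' e'S ->] f'].
  move=> [kE]; rewrite -kE in f' *; congr (_, _); move: eS e'S; rewrite !inE => eS e'S.
  exact: fan_ends_unique nimp ce0 e0x fx2 eS e'S f f'.
have : #|T| <= #|S :\ e0|.
  rewrite -(card_in_imset snd_inj); apply: leq_trans (leq_imset_card c _).
  apply/subset_leq_card/subsetP=> _ /imsetP[[y k] + ->] /=; rewrite inE /=.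
  case/andP=> /imsetP[e eS ->] f; have := eS; rewrite inE => conn.
  have : ~~ free c x k by apply/negP=> fx; apply: nimp; apply: (fan_improvable _ _ _ conn fx f).
  rewrite negb_forall => /existsP[e']; rewrite negb_imply negbK => /andP[e'x /eqP ce'].
  apply/imsetP; exists e' => //; rewrite !inE; apply/andP; split.
    by apply/eqP=> e'E; rewrite e'E ce0 in ce'.
  by apply: connect_trans conn (connect1 _); rewrite /fan_step e'x ce'.
have := cardsD1 e0 S; rewrite inE connect0; lia.
Qed.

Lemma proper_coloring_total : exists2 c, proper c & forall e, c e.
Proof.
pose c0 : {ffun E -> option K} := [ffun _ => None].
have c0P : proper c0 by apply/properP=> e e' v k _ _; rewrite ffunE.
have [c cP cmin] := arg_minnP uncolored c0P.
exists c => // e; case ce: (c e) => //; exfalso.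
by apply: uncolored_improvable cP ce _ => -[c' [/cmin + lt]]; rewrite leqNgt lt.
Qed.

End EdgeColoring.

Theorem vizing_multigraph (E F : finType) (a b : E -> F) (D mu : nat) :
    (forall e, a e != b e) ->
    (forall v, #|[set e | inc a b e v]| <= D) ->
    (forall u v, u != v -> #|[set e | inc a b e u && inc a b e v]| <= mu) ->
  exists2 c : E -> nat, forall e, c e < D + mu &
    forall e e' v, inc a b e v -> inc a b e' v -> e != e' -> c e != c e'.
Proof.
move=> ab deg mult.
have [c /properP cP cT] := proper_coloring_total ab deg mult (card_ord (D + mu)).
exists (fun e => oapp (@nat_of_ord _) 0 (c e)) => [e|e e' v ev e'v].
  by have := cT e; case: (c e) => //= i _; apply: ltn_ord.
apply: contraNneq; have := cT e; have := cT e'.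
case ce: (c e) => [i|//]; case ce': (c e') => [i'|//] _ _ /= /ord_inj iE.
by apply/eqP; apply: (cP _ _ _ _ ev e'v ce); rewrite iE.
Qed.

(** * The genus inequality and edge cuts of plane graphs *)

Lemma porbit_invariant (T : finType) (K : eqType) (s : {perm T}) (k : T -> K) :
  (forall z, k (s z) = k z) -> forall x y, x \in porbit s y -> k x = k y.
Proof.
move=> ks x y /porbitP[i ->]; elim: i => [|i IHi]; first by rewrite expg0 perm1.
by rewrite expgSr permM ks.
Qed.

Lemma porbit_fconnect (T : finType) (s : {perm T}) (f : T -> T) :
  s =1 f -> forall x y, (y \in porbit s x) = fconnect f x y.
Proof.
move=> sf x y; have iterE i : ((s ^+ i)%g x) = iter i f x.
  by rewrite permX; apply: eq_iter.
apply/porbitP/idP => [[i ->]|/iter_findex <-].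
  by rewrite iterE fconnect_iter.
by exists (findex f x y); rewrite iterE.
Qed.

Lemma card_porbits_fcard (T : finType) (s : {perm T}) (f : T -> T) :
  s =1 f -> #|porbits s| = fcard f T.
Proof.
move=> sf; have f_inj : injective f by move=> x y; rewrite -!sf => /perm_inj.
have symf := fconnect_sym f_inj.
have -> : porbits s = porbit s @: froots f.
  apply/setP=> A; apply/imsetP/imsetP => -[x _ ->]; last by exists x.
  exists (froot f x); first exact: roots_root.
  by apply/eqP; rewrite eq_porbit_mem (porbit_fconnect sf) symf connect_root.
rewrite card_in_imset => [|x y]; first by apply: eq_card => x; rewrite !inE andbT.
rewrite -!topredE /= => /eqP rx /eqP ry /eqP; rewrite eq_porbit_mem.
by rewrite (porbit_fconnect sf) -(root_connect symf) rx ry => /eqP.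
Qed.

(** A transposition of distinct points splits their common cycle or merges their two cycles. *)
Lemma card_porbits_mul_tperm (T : finType) (s : {perm T}) (x y : T) :
  #|porbits (tperm x y * s)| + (x \notin porbit s y).*2
    = #|porbits s| + (x != y).
Proof. exact: porbits_mul_tperm. Qed.

Section Genus.

Variables (D : finType) (s : {perm D}) (r : D -> D).
Hypotheses (rK : involutive r) (r_neq : forall d, r d != d).

(* Inserting the edges of [X] one at a time multiplies the face permutation by a
   transposition; a transposition whose ends lie in two different components,
   recorded by the labels [k], can only merge two faces. *)
Lemma genus_inequality (X : {set D}) (p : {perm D}) :
    (forall d, (r d \in X) = (d \in X)) ->
    (forall d, p d = if d \in X then r d else d) ->
  exists k : D -> {set D},
    [/\ forall d, k (s d) = k d, forall d, d \in X -> k (r d) = k d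
      & #|porbits (p * s)| + #|porbits s| <= #|X|./2 + 2 * #|k @: D| ].
Proof.
have [n] := ubnP #|X|; elim: n => // n IHn in X p *; rewrite ltnS => leXn Xr pE.
have [X0|[x xX]] := set_0Vmem X.
  exists (porbit s); split=> [d|d|].
  - by apply/eqP; rewrite eq_porbit_mem; apply: (mem_porbit s 1).
  - by rewrite X0 inE.
  have -> : p = 1%g by apply/permP=> d; rewrite pE X0 inE perm1.
  by rewrite mul1g addnn -mul2n leq_addl.
pose X' := X :\ x :\ r x; pose p' := (tperm x (r x) * p)%g.
have cardX : #|X| = #|X'|.+2.
  by rewrite (cardsD1 x) xX (cardsD1 (r x) (X :\ x)) !inE r_neq Xr xX.
have X'r d : (r d \in X') = (d \in X').
  rewrite !inE Xr (inj_eq (inv_inj rK)) -(inv_eq rK d).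
  by rewrite [in RHS]andbCA (eq_sym (r d)) eq_sym.
have p'E d : p' d = if d \in X' then r d else d.
  rewrite permM !inE; case: tpermP => [->|->|/eqP nx /eqP nrx].
  - by rewrite pE Xr xX rK eqxx andbF.
  - by rewrite pE xX eqxx.
  by rewrite pE nx nrx.
have ltX' : #|X'| < n by lia.
have [k [ks kr le_k]] := IHn X' p' ltX' X'r p'E.
have kp d : k ((p' * s)%g d) = k d.
  by rewrite permM ks p'E; case: ifP => // /kr.
have pE' : p = (tperm x (r x) * p')%g by rewrite mulgA tperm2 mul1g.
have eqz : #|porbits (p * s)| + (x \notin porbit (p' * s) (r x)).*2
             = #|porbits (p' * s)| + (x != r x).
  by rewrite {1}pE' -mulgA; apply: card_porbits_mul_tperm.
(* Within one component the orbit count grows by at most one, which the new edge pays for. *)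
have [kx|nkx] := eqVneq (k x) (k (r x)).
  exists k; split=> // [d dX|]; last first.
    by move: eqz; case: (x != r x); case: (x \notin _); lia.
  have [->|nx] := eqVneq d x; first by [].
  have [->|nrx] := eqVneq d (r x); first by rewrite rK.
  by apply: kr; rewrite !inE nx nrx.
(* The two labels are identified. The term [2 * #|k @: D|] drops by at most 2, balanced by the new
   edge and the loss of one orbit. *)
exists (fun d => if k d == k (r x) then k x else k d); split=> [d|d dX|].
- by rewrite ks.
- have [->|nx] := eqVneq d x; first by rewrite eqxx (negPf nkx).
  have [->|nrx] := eqVneq d (r x); first by rewrite rK eqxx (negPf nkx).
  by rewrite kr // !inE nx nrx.
have Nx : x \notin porbit (p' * s) (r x).
  by apply: contraNN nkx => /(porbit_invariant kp) ->.
have : (k @: D) :\ k (r x) \subset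
    [set if k d == k (r x) then k x else k d | d in D].
  apply/subsetP=> A /setD1P[nA /imsetP[d _ dA]]; apply/imsetP; exists d => //.
  by rewrite -dA (negPf nA).
move/subset_leq_card; have := cardsD1 (k (r x)) (k @: D).
rewrite imset_f //; move: eqz; rewrite Nx; case: (x != r x); lia.
Qed.

End Genus.

(** Label points by their orbits under the product. The transposition preserves these labels,
    because [x] and [y] share one, and hence so does [s]. *)
Lemma mul_tperm_porbit_sub (T : finType) (s : {perm T}) (x y u v : T) :
    x \in porbit (tperm x y * s) y -> u \in porbit s v ->
  u \in porbit (tperm x y * s) v.
Proof.
set t := tperm x y; move=> xy; rewrite -eq_porbit_mem => uv.
pose k := porbit (t * s)%g; have kxy : k x = k y by apply/eqP; rewrite eq_porbit_mem.
have kt z : k (t z) = k z by rewrite /t; case: tpermP => [->|->|].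
rewrite -eq_porbit_mem; apply/eqP; apply: (@porbit_invariant _ _ s k) => [z|].
  rewrite -[RHS]kt -{1}[z](tpermK x y); apply/eqP; rewrite eq_porbit_mem -permM.
  exact: (mem_porbit (t * s) 1).
by rewrite -eq_porbit_mem.
Qed.

Lemma vertex_dart (G : plane_graph) (v : vert G) :
  1 < #|vert G| -> exists d : dart G, src d == v.
Proof.
move=> /card_gt1P[x [y [_ _ nxy]]].
have [z nz] : exists z, z != v.
  by have [<-|] := eqVneq x v; [exists y; rewrite eq_sym | exists x].
have /connectP[[|w p]] := plane_connected v z; first by move=> _ zv; rewrite zv eqxx in nz.
by case/andP=> /existsP[d /andP[sd _]] _ _; exists d.
Qed.

Section Cut.

Variable G : plane_graph.

Definition drot_perm : {perm dart G} := perm (@drot_inj G).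
Definition drev_perm : {perm dart G} := perm (inv_inj (@drevK G)).

Lemma drev_neq (d : dart G) : drev d != d.
Proof. by apply: contraNneq (no_loop d) => ->. Qed.

Lemma face_next_inj : injective (@face_next G).
Proof. by move=> x y /drot_inj /(inv_inj (@drevK G)). Qed.

Lemma face_permE (d : dart G) : (drev_perm * drot_perm)%g d = face_next d.
Proof. by rewrite permM !permE. Qed.

Lemma euler_porbits :
  #|vert G| + #|porbits (drev_perm * drot_perm)| = #|dart G|./2 + 2.
Proof. by rewrite (card_porbits_fcard face_permE) -euler_formula. Qed.

Lemma card_drot_porbits : 1 < #|vert G| -> #|porbits drot_perm| = #|vert G|.
Proof.
move=> V1; have src_porbit d d' :
    (porbit drot_perm d == porbit drot_perm d') = (src d == src d').
  by rewrite eq_porbit_mem (porbit_fconnect (permE _)) drot_orbit eq_sym.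
pose f v := porbit drot_perm (xchoose (vertex_dart v V1)).
have srcf v : src (xchoose (vertex_dart v V1)) = v := eqP (xchooseP (vertex_dart v V1)).
have f_inj : injective f by move=> u v /eqP; rewrite src_porbit !srcf => /eqP.
rewrite -(card_imset _ f_inj); apply: eq_card => A.
apply/imsetP/imsetP => -[x _ ->]; last by eexists.
by exists (src x) => //; apply/eqP; rewrite src_porbit srcf.
Qed.

(** [X] holds the darts of the kept edges; deleted darts stay in the rotation as half-edges fixed by
    [p]. The genus inequality forces at least two labels, each constant around a vertex and along
    kept edges, so one label class is a union of components. *)
Lemma plane_cut (X : {set dart G}) (p : {perm dart G}) :
    1 < #|vert G| -> (forall d, (drev d \in X) = (d \in X)) ->
    (forall d, p d = if d \in X then drev d else d) ->
    #|X|./2 + 2 < #|porbits (p * drot_perm)| + #|vert G| ->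
  exists A : {set vert G}, [/\ exists u, u \in A, exists v, v \notin A
    & forall d, d \in X -> (src d \in A) = (src (drev d) \in A)].
Proof.
move=> V1 Xr pE; rewrite -(card_drot_porbits V1) => ltX.
have [k [ks kr le_k]] := genus_inequality drot_perm (@drevK G) drev_neq Xr pE.
have /card_gt1P[_ [_ [/imsetP[d1 _ ->] /imsetP[d2 _ ->] nk]]] : 1 < #|k @: dart G|.
  by move: (leq_trans ltX le_k); lia.
pose A := [set v | [exists d, (src d == v) && (k d == k d1)]].
have inA d : (src d \in A) = (k d == k d1).
  rewrite inE; apply/existsP/idP => [[d' /andP[sd /eqP <-]]|]; last by exists d; rewrite eqxx.
  by apply/eqP; apply: (porbit_invariant ks); rewrite (porbit_fconnect (permE _)) drot_orbit.
exists A; split=> [||d dX]; last by rewrite !inA kr.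
- by exists (src d1); rewrite inA.
- by exists (src d2); rewrite inA eq_sym.
Qed.

(** Deleting an edge with the same face on both sides splits that face: one face more and one edge
    less exceed the bound for a connected graph. *)
Lemma bridge_cut (d : dart G) : 1 < #|vert G| -> fconnect (@face_next G) d (drev d) ->
  exists A : {set vert G}, [/\ exists u, u \in A, exists v, v \notin A
    & forall d', d' != d -> d' != drev d -> (src d' \in A) = (src (drev d') \in A)].
Proof.
move=> V1 dd; pose X := ~: [set d; drev d].
have [||||A [A1 A2 A3]] := @plane_cut X (tperm d (drev d) * drev_perm).
- by [].
- move=> d'; rewrite !inE (inj_eq (inv_inj (@drevK G))) (can2_eq (@drevK G) (@drevK G)).
  by rewrite orbC.
- move=> d'; rewrite permM !permE /= !inE negb_or.
  by case: eqP => [->|_]; [rewrite drevK | case: eqP => // ->].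
- rewrite -mulgA.
  have := card_porbits_mul_tperm (drev_perm * drot_perm) d (drev d).
  rewrite porbit_sym (porbit_fconnect face_permE) dd eq_sym drev_neq.
  have := cardsC [set d; drev d]; rewrite -/X cards2 eq_sym drev_neq.
  have := euler_porbits; set F := #|porbits (_ * _)|; set z := #|porbits _|.
  by set n := #|vert G|; lia.
exists A; split=> // d' n1 n2; apply: A3; by rewrite !inE negb_or n1.
Qed.

(* In the dual graph the two edges form a digon, that is, a closed curve. *)
Lemma digon_cut (d1 d2 : dart G) :
    1 < #|vert G| -> d2 != d1 -> d2 != drev d1 ->
    ~~ fconnect (@face_next G) d1 (drev d1) ->
    fconnect (@face_next G) d1 d2 -> fconnect (@face_next G) (drev d1) (drev d2) ->
  exists A : {set vert G}, [/\ exists u, u \in A, exists v, v \notin A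
    & forall d, d \notin [:: d1; drev d1; d2; drev d2] ->
        (src d \in A) = (src (drev d) \in A)].
Proof.
move=> V1 n1 n2 nf f1 f2; pose X := [set d | d \notin [:: d1; drev d1; d2; drev d2]].
have drev_eq (x y : dart G) : (drev x == y) = (x == drev y).
  exact: (can2_eq (@drevK G) (@drevK G)).
have [||||A [A1 A2 A3]] :=
  @plane_cut X (tperm d2 (drev d2) * (tperm d1 (drev d1) * drev_perm)).
- by [].
- move=> d; rewrite !inE !drev_eq !drevK.
  by case: (d == d1); case: (d == drev d1); case: (d == d2); case: (d == _).
- move=> d; rewrite !permM !permE /= !inE.
  have [->|nd2] := eqVneq d d2.
    by rewrite !orbT /= drev_eq (negPf n2) (inj_eq (inv_inj (@drevK G))) (negPf n1) drevK.
  have [->|ndr2] := eqVneq d (drev d2); first by rewrite !orbT /= (negPf n1) (negPf n2).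
  have [->|nd1] := eqVneq d d1; first by rewrite drevK.
  by have [->|_] := eqVneq d (drev d1).
- rewrite -!mulgA; set s1 := (tperm d1 _ * _)%g.
  have eq1 := card_porbits_mul_tperm (drev_perm * drot_perm) d1 (drev d1).
  rewrite /= -/s1 porbit_sym (porbit_fconnect face_permE) nf in eq1.
  rewrite eq_sym drev_neq in eq1.
  (* Deleting the first edge merged its two faces. Multiplying [s1] by the same transposition
     restores the larger orbit count, which is possible only if both darts lie in one orbit of
     [s1]. *)
  have in1 : d1 \in porbit s1 (drev d1).
    have := card_porbits_mul_tperm s1 d1 (drev d1).
    rewrite /= mulgA tperm2 mul1g eq_sym drev_neq.
    by case: (d1 \in _) => //; move: eq1; set z := #|porbits s1|; set F := #|_|; lia.
  (* The merged face has absorbed the faces of [d2] and of [drev d2], so deleting the second edge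
     splits it. The orbit count is back at its original value with two edges fewer. *)
  have in2 : d2 \in porbit s1 (drev d2).
    rewrite -eq_porbit_mem.
    have := mul_tperm_porbit_sub in1; rewrite -/s1 => sub.
    have /sub : d2 \in porbit (drev_perm * drot_perm) d1 by rewrite (porbit_fconnect face_permE).
    have /sub : drev d2 \in porbit (drev_perm * drot_perm) (drev d1).
      by rewrite (porbit_fconnect face_permE).
    by move: in1; rewrite -!eq_porbit_mem => /eqP <- /eqP -> /eqP ->.
  have := card_porbits_mul_tperm s1 d2 (drev d2).
  rewrite /= in2 /= addn0 eq_sym drev_neq => ->.
  have cardX : #|X| + 4 = #|dart G|.
    have U : uniq [:: d1; drev d1; d2; drev d2].
      rewrite /= !inE !negb_or (eq_sym d1) drev_neq (eq_sym d1 d2) n1.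
      rewrite (eq_sym _ d2) n2 (eq_sym d2) drev_neq (inj_eq (inv_inj (@drevK G))).
      by rewrite (eq_sym d1 d2) n1 -drev_eq (eq_sym _ d2) n2.
    rewrite -(cardC (mem [:: d1; drev d1; d2; drev d2])) addnC; congr (_ + _).
      by rewrite -[4]/(size [:: d1; drev d1; d2; drev d2]) -(card_uniqP U).
    by apply: eq_card => d; rewrite !inE.
  have := euler_porbits; move: eq1; set F := #|porbits (drev_perm * _)|.
  by set z := #|porbits _|; set n := #|vert G|; lia.
exists A; split=> // d nd; apply: A3; by rewrite inE.
Qed.

End Cut.

(** * Faces of 3-connected plane graphs *)

(** Removing one end of each of the two edges destroys every edge that may cross [A], yet leaves the
    graph connected, so all remaining vertices lie on one side. *)
Lemma connected3_no_cut (G : multigraph) (A : {set vert G}) (d1 d2 : dart G) :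
    k_connected 3 G ->
    (forall d, d \notin [:: d1; drev d1; d2; drev d2] ->
       (src d \in A) = (src (drev d) \in A)) ->
  forall z z', (z \in A) = (z' \in A).
Proof.
case=> V4 conn crossA.
pose u1 := src d1; pose v1 := src (drev d1); pose u2 := src d2; pose v2 := src (drev d2).
have n1 : v1 != u1 := no_loop d1.
have n2 : v2 != u2 := no_loop d2.
have sep x y z z' : x \in [:: u1; v1] -> y \in [:: u2; v2] ->
    z \notin [:: x; y] -> z' \notin [:: x; y] -> (z \in A) = (z' \in A).
  move=> x1 y2 zS z'S; have cS : #|[set x; y]| < 3 by rewrite cards2; case: (x != y).
  have inS w : (w \in [:: x; y]) = (w \in [set x; y]) by rewrite !inE.
  rewrite inS in zS; rewrite inS in z'S.
  have /connectP[p pth ->] := conn _ cS z z' zS z'S.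
  elim: p z zS pth => //= w p IHp z zS /andP[/andP[/existsP[d /andP[/eqP dz /eqP dw]] wS]].
  move/(IHp _ wS) <-; rewrite -dz -dw; apply: crossA.
  apply/negP=> d4; move: zS wS x1 y2; rewrite -dz -dw !inE.
  by move: d4; rewrite !inE => /or4P[] /eqP -> /norP[q1 q2] /norP[q3 q4];
    move=> /orP[] /eqP xE /orP[] /eqP yE; move: q1 q2 q3 q4;
    rewrite xE yE ?drevK !eqxx.
have avoid (u v z : vert G) : v != u -> exists2 x, x \in [:: u; v] & z != x.
  move=> nvu; have [->|nzu] := eqVneq z u; last by exists u; rewrite ?inE ?eqxx.
  by exists v; rewrite ?inE ?eqxx ?orbT // eq_sym.
(* A vertex [w] off both edges can be compared with any [z], by removing from each edge an end other
   than [z]. Without such a [w], the at least four vertices are exactly the four ends, which are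
   then distinct and compared pairwise. *)
have [w wout|all4] := pickP [pred w | w \notin [:: u1; v1; u2; v2]].
  have to_w z : (z \in A) = (w \in A).
    have [x x1 zx] := avoid _ _ z n1; have [y y2 zy] := avoid _ _ z n2.
    apply: (sep x y) => //; rewrite !inE negb_or ?zx ?zy //.
    move: wout x1 y2; rewrite /= !inE !negb_or => /and4P[w1 w2 w3 w4].
    by move=> /orP[] /eqP -> /orP[] /eqP ->; apply/andP.
  by move=> z z'; rewrite !to_w.
have U : uniq [:: u1; v1; u2; v2].
  apply/card_uniqP; apply/eqP; rewrite eqn_leq card_size /=.
  apply: leq_trans V4 _; apply: subset_leq_card; apply/subsetP=> z _.
  by have /negbFE := all4 z.
move: U; rewrite /= !inE !negb_or => /and4P[/and3P[a1 a2 a3] /andP[a4 a5] a6 _].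
have e1 : (v1 \in A) = (v2 \in A).
  by apply: (sep u1 u2); rewrite !inE ?eqxx ?negb_or ?n1 ?n2 ?a4 // eq_sym a3.
have e2 : (u1 \in A) = (u2 \in A).
  by apply: (sep v1 v2); rewrite !inE ?eqxx ?orbT ?negb_or ?a1 ?a3 ?a6 ?andbT // eq_sym a4.
have e3 : (v1 \in A) = (u2 \in A).
  by apply: (sep u1 v2); rewrite !inE ?eqxx ?orbT ?negb_or ?n1 ?a5 ?a6 ?andbT // eq_sym a2.
have all_u2 z : (z \in A) = (u2 \in A).
  by have /negbFE := all4 z; rewrite !inE => /or4P[] /eqP ->; rewrite // -?e1.
by move=> z z'; rewrite !all_u2.
Qed.

Section Connected3.

Variable G : plane_graph.
Hypothesis G3 : k_connected 3 G.

Let V1 : 1 < #|vert G|.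
Proof. by case: G3 => /ltnW/ltnW. Qed.

Lemma edge_faces_neq (d : dart G) : ~~ fconnect (@face_next G) d (drev d).
Proof.
apply/negP=> /(bridge_cut V1)[A [[u uA] [v vA] crossA]].
(* A bridge is treated as a pair of equal edges. *)
move: vA; rewrite (connected3_no_cut (d1 := d) (d2 := d) G3 _ v u) ?uA // => d'.
by rewrite !inE !negb_or => /and4P[n1 n2 _ _]; apply: crossA.
Qed.

Lemma edge_of_faces (d1 d2 : dart G) :
  fconnect (@face_next G) d1 d2 -> fconnect (@face_next G) (drev d1) (drev d2) ->
  d2 = d1.
Proof.
move=> f1 f2; have [//|n1] := eqVneq d2 d1.
have [d2E|n2] := eqVneq d2 (drev d1).
  by move: f1; rewrite d2E (negPf (edge_faces_neq d1)).
have [A [[u uA] [v vA] crossA]] := digon_cut V1 n1 n2 (edge_faces_neq d1) f1 f2.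
by move: vA; rewrite (connected3_no_cut G3 crossA v u) uA.
Qed.

(** Three consecutive vertices of the face walk are distinct: a return after two steps would, by
    simplicity, use [drev d], putting both sides of the edge on one face. *)
Lemma face_degree_ge3 (d : dart G) : simple_graph G -> 3 <= face_degree d.
Proof.
move=> simpleG; pose f := @face_next G.
have srcf d' : src (f d') = src (drev d').
  by apply/eqP; rewrite eq_sym -drot_orbit fconnect1.
have inF i : src (iter i f d) \in face_verts d by apply: imset_f; apply: fconnect_iter.
have neq1 d' : src (f d') != src d' by rewrite srcf no_loop.
have neq2 : src (f (f d)) != src d.
  apply/eqP=> eq2; have fd : f d = drev d.
    by apply: simpleG; rewrite ?srcf // drevK -srcf.
  by have := edge_faces_neq d; rewrite -fd fconnect1.
apply/card_geqP; exists [:: src d; src (f d); src (f (f d))]; split=> //.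
  by rewrite /= !inE !negb_or !(eq_sym (src d)) neq1 neq2 eq_sym neq1.
move=> v; rewrite !inE => /or3P[] /eqP ->; [exact: (inF 0)|exact: (inF 1)|exact: (inF 2)].
Qed.

End Connected3.

(** * Subdivisions *)

(* [old] embeds the vertices of [R], [par] sends a dart of [G] to the dart of [R]
   it is a segment of, and [hd] sends a dart of [R] to its first segment. *)
Record subdivision_map (R G : plane_graph) := SubdivisionMap {
  old : vert R -> vert G;
  par : dart G -> dart R;
  hd : dart R -> dart G;
  old_inj : injective old;
  par_hd : cancel hd par;
  src_hd : forall e, src (hd e) = old (src e);
  hd_par : forall g, src g \in codom old -> hd (par g) = g;
  par_drev : forall g, par (drev g) = drev (par g);
  face_next_par : forall g, face_next g = hd (face_next (par g)) \/
    (par (face_next g) = par g /\ src (face_next g) \notin codom old);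
  new_drot : forall g, src g \notin codom old ->
    drot (drot g) = g /\ par (drot g) = drev (par g);
  fconnect_hd_par : forall g, fconnect (@face_next G) (hd (par g)) g;
  fconnect_hd_next : forall e,
    fconnect (@face_next G) (hd e) (hd (face_next e));
  new_src : forall w, w \notin codom old -> exists g, src g == w
}.

Lemma subdivision_map_refl (R : plane_graph) : inhabited (subdivision_map R R).
Proof.
have all_old (v : vert R) : v \in codom id by apply: codom_f.
split; exists id id id => //.
- by left.
- by move=> g; rewrite all_old.
- by move=> e; apply: fconnect1.
- by move=> w; rewrite all_old.
Qed.

Lemma subdivision_map_step (R G H : plane_graph) :
  subdivision_map R G -> subdivides_edge G H -> inhabited (subdivision_map R H).
Proof.
move=> m [e [fV [fD [fV_bij fD_bij [srcl srcr] drevl [rotl rotr]]]]].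
have fV_inj := bij_inj fV_bij; have fD_inj := bij_inj fD_bij.
have [dD fDK dDK] := fD_bij; have [dV fVK dVK] := fV_bij.
have dartP (P : dart H -> Prop) :
    (forall d, P (fD (inl d))) -> (forall b, P (fD (inr b))) -> forall g, P g.
  by move=> Pl Pr g; rewrite -(dDK g); case: (dD g).
have drev_e : drev (fD (inl e)) = fD (inr false) by rewrite drevl eqxx.
have drev_re : drev (fD (inl (drev e))) = fD (inr true).
  by rewrite drevl (negPf (drev_neq e)) eqxx.
have drevr b : drev (fD (inr b)) = fD (inl (if b then drev e else e)).
  by case: b; rewrite -?drev_e -?drev_re drevK.
have next_e : face_next (fD (inl e)) = fD (inr true).
  by rewrite /face_next drev_e rotr.
have next_re : face_next (fD (inl (drev e))) = fD (inr false).
  by rewrite /face_next drev_re rotr.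
have nextl d : d != e -> d != drev e -> face_next (fD (inl d)) = fD (inl (face_next d)).
  by move=> n1 n2; rewrite /face_next drevl (negPf n1) (negPf n2) rotl.
have nextr b : face_next (fD (inr b)) = fD (inl (face_next (if b then e else drev e))).
  by rewrite /face_next drevr rotl; case: b; rewrite ?drevK.
pose old' v := fV (Some (old m v)).
(* The new dart [fD (inr true)] is the reverse of the segment of [drev e], so it runs along [e];
   symmetrically, [fD (inr false)] runs along [drev e]. *)
pose par' g := match dD g with inl d => par m d
               | inr b => par m (if b then e else drev e) end.
pose hd' d := fD (inl (hd m d)).
have par'l d : par' (fD (inl d)) = par m d by rewrite /par' fDK.
have par'r b : par' (fD (inr b)) = par m (if b then e else drev e) by rewrite /par' fDK.
have oldS v : (fV (Some v) \in codom old') = (v \in codom (old m)).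
  apply/codomP/codomP => -[u]; last by move=> ->; exists u.
  by move/fV_inj=> [->]; exists u.
have oldN : fV None \notin codom old'.
  by apply/codomP=> -[u /fV_inj].
(* One face step of [G] becomes two steps of [H] at [e] and [drev e], with a new dart in between,
   and stays one step elsewhere. *)
have conn1 d : fconnect (@face_next H) (fD (inl d)) (fD (inl (face_next d))).
  have [->|n1] := eqVneq d e.
    apply: (connect_trans (fconnect1 _ _)); rewrite next_e.
    by rewrite -[fD (inl _)](nextr true) fconnect1.
  have [->|n2] := eqVneq d (drev e).
    apply: (connect_trans (fconnect1 _ _)); rewrite next_re.
    by rewrite -[fD (inl _)](nextr false) fconnect1.
  by rewrite -nextl // fconnect1.
have connl d d' : fconnect (@face_next G) d d' ->
    fconnect (@face_next H) (fD (inl d)) (fD (inl d')).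
  move=> /iter_findex <-; elim: findex => [|i IHi]; first exact: connect0.
  by rewrite iterS; apply: connect_trans IHi (conn1 _).
split; exists old' par' hd'.
- by move=> u v /fV_inj[] /(@old_inj _ _ m).
- by move=> d; rewrite par'l par_hd.
- by move=> d; rewrite srcl src_hd.
- apply: dartP => [d|b]; last by rewrite srcr (negPf oldN).
  by rewrite srcl oldS par'l /hd' => /hd_par ->.
- apply: dartP => [d|b]; last by rewrite drevr par'l par'r; case: b; rewrite par_drev ?drevK.
  rewrite drevl par'l; case: eqP => [->|_]; first by rewrite par'r par_drev.
  by case: eqP => [->|_]; rewrite ?par'r ?par'l par_drev ?drevK.
- have stepl d : (fD (inl (face_next d)) = hd' (face_next (par m d))) \/
      (par' (fD (inl (face_next d))) = par m d /\
       src (fD (inl (face_next d))) \notin codom old').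
    by rewrite par'l srcl oldS /hd'; case: (face_next_par m d) => [<-|]; [left|right].
  apply: dartP => [d|b]; last by rewrite nextr par'r; apply: stepl.
  rewrite (par'l d); have [->|n1] := eqVneq d e.
    by right; rewrite next_e par'r srcr oldN.
  have [->|n2] := eqVneq d (drev e).
    by right; rewrite next_re par'r srcr oldN.
  by rewrite nextl //; apply: stepl.
- apply: dartP => [d|b].
    by rewrite srcl oldS !rotl !par'l => /(new_drot (s := m))[-> ->].
  by rewrite !rotr !par'r negbK => _; case: b; rewrite /= par_drev ?drevK.
- apply: dartP => [d|b]; first by rewrite par'l; apply/connl/fconnect_hd_par.
  rewrite par'r; apply: connect_trans (connl _ _ (fconnect_hd_par _ _)) _.
  by case: b; rewrite -?next_e -?next_re fconnect1.
- by move=> d; apply/connl/fconnect_hd_next.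
- move=> w; rewrite -(dVK w); case: (dV w) => [v|_]; last first.
    by exists (fD (inr true)); rewrite srcr.
  rewrite oldS => /new_src[g /eqP <-]; by exists (fD (inl g)); rewrite srcl.
Qed.

Lemma subdivision_mapP (R G : plane_graph) :
  subdivision R G -> inhabited (subdivision_map R G).
Proof.
elim=> [|G' H _ [m] sub]; first exact: subdivision_map_refl.
exact: subdivision_map_step m sub.
Qed.

Section SubdivisionMap.

Variables (R G : plane_graph) (m : subdivision_map R G).
Local Notation is_new w := (w \notin codom (old m)).

Lemma fconnect_par (g g' : dart G) :
  fconnect (@face_next G) g g' -> fconnect (@face_next R) (par m g) (par m g').
Proof.
move=> /iter_findex <-; elim: findex => [|i IHi]; first exact: connect0.
rewrite iterS; apply: connect_trans IHi _.
by case: (face_next_par m (iter i (@face_next G) g)) => [->|[-> //]]; rewrite par_hd fconnect1.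
Qed.

Lemma fconnect_of_par (g g' : dart G) :
  fconnect (@face_next R) (par m g) (par m g') -> fconnect (@face_next G) g g'.
Proof.
move=> conn; have symG := fconnect_sym (@face_next_inj G).
suff hds : fconnect (@face_next G) (hd m (par m g)) (hd m (par m g')).
  apply: connect_trans (connect_trans hds (fconnect_hd_par m g')).
  by rewrite symG fconnect_hd_par.
rewrite -(iter_findex conn); elim: findex => [|i IHi]; first exact: connect0.
by rewrite iterS; apply: connect_trans IHi (fconnect_hd_next _ _).
Qed.

Lemma new_darts (g g' : dart G) :
  is_new (src g) -> src g' = src g -> g' = g \/ g' = drot g.
Proof.
move=> gN sgg'; have [drot2 _] := new_drot gN.
have : fconnect (@drot G) g g' by rewrite drot_orbit sgg'.
move=> /iter_findex <-; elim: findex => [|i]; first by left.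
by rewrite iterS => -[->|->]; [right|left].
Qed.

Lemma new_par (g g' : dart G) :
  is_new (src g) -> src g' = src g -> par m g' = par m g \/ par m g' = drev (par m g).
Proof.
by move=> gN /(new_darts gN)[->|->]; [left|right; have [] := new_drot gN].
Qed.

Lemma src_drot (g : dart G) : src (drot g) = src g.
Proof. by apply/eqP; rewrite eq_sym -drot_orbit fconnect1. Qed.

Lemma new_par_inj (g g' : dart G) :
  is_new (src g) -> src g' = src g -> par m g' = par m g -> g' = g.
Proof.
move=> gN /(new_darts gN)[//|->]; have [_ ->] := new_drot gN => /eqP.
by rewrite (negPf (drev_neq _)).
Qed.

Lemma new_degree (g : dart G) : is_new (src g) -> degree (src g) = 2.
Proof.
move=> gN; rewrite /degree; have -> : [set d | src d == src g] = [set g; drot g].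
  apply/setP=> d; rewrite !inE; apply/eqP/orP => [/(new_darts gN)[->|->]|].
  - by left.
  - by right.
  - by move=> [] /eqP ->; rewrite ?src_drot.
rewrite cards2; case: eqP => // gE; have [_] := new_drot gN; rewrite -gE => /eqP.
by rewrite eq_sym (negPf (drev_neq _)).
Qed.

(** The segments of [e] are consecutive on the face walk. Going backwards from [g], the walk can
    leave [e] only at [hd m e], and that dart does not recur within one turn around the face. *)
Lemma face_walk_par (e : dart R) (g : dart G) i :
  par m g = e -> i <= findex (@face_next G) (hd m e) g ->
  par m (iter i (@face_next G) (hd m e)) = e.
Proof.
set f := @face_next G; set j := findex _ _ _; move=> ge le_ij.
have conn : fconnect f (hd m e) g by rewrite -ge fconnect_hd_par.
have lt_j := findex_max conn.
rewrite -(subKn le_ij); elim: (j - i) => [|k IHk]; first by rewrite subn0 iter_findex.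
have [le_jk|lt_kj] := leqP j k.
  by move: IHk; rewrite (eqP le_jk) (eqP (leqW le_jk : j - k.+1 == 0)).
move: IHk; rewrite -(subnSK lt_kj) iterS; set y := iter _ f _ => fyE.
case: (face_next_par m y) => [fy|[<- //]].
move: fyE; rewrite -/f in fy; rewrite fy par_hd => nextE.
have lt_o : (j - k.+1).+1 < fingraph.order f (hd m e).
  by rewrite subnSK //; apply: leq_ltn_trans lt_j; apply: leq_subr.
by have := findex_iter lt_o; rewrite iterS -/y fy nextE findex0.
Qed.

Lemma multiplicity_le_t_num (e : dart R) :
  #|[set w | is_new w && [exists g, (src g == w) && (par m g == e)]]| <= t_num G.
Proof.
set f := @face_next G; set x := hd m e.
(* [g0] is the last segment of [e]. The list [s] starts after [x], whose source is old, so its [n]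
   sources are the new vertices on [e], in path order. *)
have [g0 /eqP g0e g0max] := @arg_maxnP _ x [pred g | par m g == e] (findex f x)
  (introT eqP (par_hd m e)).
set n := findex f x g0 in g0max; pose s := traject f (f x) n.
have conn g : par m g = e -> fconnect f x g by move=> ge; rewrite /x -ge fconnect_hd_par.
have lt_n : n < fingraph.order f x by apply/findex_max/conn.
have s_iter g : g \in s -> exists2 i, 0 < i <= n & g = iter i f x.
  by case/trajectP=> i lt_in ->; exists i.+1; rewrite ?iterSr.
have par_s g : g \in s -> par m g = e.
  by case/s_iter=> i /andP[_ le_in] ->; apply: face_walk_par g0e _.
have new_s g : g \in s -> is_new (src g).
  move=> gs; apply/negP=> /hd_par; rewrite (par_s _ gs) => xE.
  have [i /andP[i0 le_in] gE] := s_iter g gs.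
  have := findex_iter (leq_ltn_trans le_in lt_n); rewrite -gE -xE findex0 => iE.
  by rewrite -iE in i0.
have s_uniq : uniq s.
  have : uniq (traject f x n.+1).
    by rewrite -(take_traject f x lt_n) take_uniq // orbit_uniq.
  by case/andP.
have P_uniq : uniq (map (@src G) s).
  rewrite map_inj_in_uniq // => g g' gs g's sgg'.
  by apply: new_par_inj; rewrite ?new_s ?par_s.
have size_P : size (map (@src G) s) = n by rewrite size_map size_traject.
apply: (@leq_trans n).
  rewrite -size_P -(card_uniqP P_uniq); apply/subset_leq_card/subsetP=> w.
  rewrite inE => /andP[wN /existsP[g /andP[/eqP gw /eqP ge]]].
  rewrite -gw map_f //; apply/trajectP; have gx := conn g ge.
  have : findex f x g <= n by apply: g0max; apply/eqP.
  case iE: (findex f x g) => [|i] le_in; last first.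
    by exists i => //; rewrite -iterSr -iE iter_findex.
  move/eqP: iE; rewrite findex_eq0 => /eqP xg; move: wN.
  by rewrite -gw -xg src_hd codom_f.
have n_lt : n < #|vert G|.+1 by rewrite ltnS -size_P -(card_uniqP P_uniq) max_card.
apply: (leq_bigmax_cond (Ordinal n_lt)); apply/existsP.
exists (@Tuple n _ _ (introT eqP size_P)); apply/and3P; split=> //=.
  rewrite sorted_map; apply: (@sub_sorted _ (frel f)) => [g g' /eqP <-|].
    by apply/existsP; exists g; rewrite eqxx /f /face_next src_drot /=.
  by apply: path_sorted (fpath_traject f x n).
by apply/allP=> w /mapP[g gs ->]; rewrite new_degree ?new_s.
Qed.

End SubdivisionMap.

(** * Coloring a subdivision *)

Lemma chi_c_le (G : plane_graph) (k : nat) (c : vert G -> nat) :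
    (forall v, c v < k) ->
    (forall d u v, u \in face_verts d -> v \in face_verts d -> u != v -> c u != c v) ->
  chi_c G <= k.
Proof.
move=> ck cP; rewrite /chi_c; case: ex_minnP => n _; apply.
apply/existsP; exists [ffun v => Ordinal (ck v)].
apply/forallP=> d; apply/forall_inP=> u ud; apply/forall_inP=> v vd.
by apply/implyP=> nuv; rewrite !ffunE -val_eqE; apply: (cP d).
Qed.

Lemma chi_c_coloring (G : plane_graph) :
  exists2 c : vert G -> nat, forall v, c v < chi_c G &
    forall d u v, u \in face_verts d -> v \in face_verts d -> u != v -> c u != c v.
Proof.
rewrite /chi_c; case: ex_minnP => n /existsP[c /forallP cP] _.
exists (fun v => nat_of_ord (c v)) => [v|d u v ud vd nuv]; first exact: ltn_ord.
by have /forall_inP/(_ u ud)/forall_inP/(_ v vd) := cP d; rewrite nuv.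
Qed.

Section NewVertices.

Variables (R G : plane_graph) (m : subdivision_map R G).
Hypotheses (R_simple : simple_graph R) (R3 : k_connected 3 R).

Local Notation new_vert := {w : vert G | w \notin codom (old m)}.
Local Notation faceR := (@face_next R).

Let symR : connect_sym (frel faceR) := fconnect_sym (@face_next_inj R).

Definition new_dart (w : new_vert) : dart G := xchoose (new_src (valP w)).

Lemma src_new_dart w : src (new_dart w) = val w.
Proof. exact/eqP/(xchooseP (new_src (valP w))). Qed.

Lemma new_dart_new w : src (new_dart w) \notin codom (old m).
Proof. by rewrite src_new_dart; apply: (valP w). Qed.

(** A face is represented by the canonical dart of its orbit in [R], so the auxiliary multigraph has
    the darts of [R] as vertices. *)
Definition left_face w := froot faceR (par m (new_dart w)).
Definition right_face w := froot faceR (drev (par m (new_dart w))).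

Lemma left_right_neq w : left_face w != right_face w.
Proof. by rewrite (root_connect symR); apply: edge_faces_neq. Qed.

Lemma inc_new_par w f : inc left_face right_face w f ->
  exists2 g, src g = val w & froot faceR (par m g) = f.
Proof.
case/orP=> /eqP <-; first by exists (new_dart w); rewrite ?src_new_dart.
have [_ par_rot] := new_drot (new_dart_new w).
by exists (drot (new_dart w)); rewrite ?src_drot ?src_new_dart // par_rot.
Qed.

Lemma face_inc w g : src g = val w -> inc left_face right_face w (froot faceR (par m g)).
Proof.
rewrite -src_new_dart => /(new_par (new_dart_new w))[] ->; rewrite /inc eqxx ?orbT //.
Qed.

Lemma new_in_face w e : inc left_face right_face w (froot faceR e) ->
  val w \in face_verts (hd m e).
Proof.
case/inc_new_par=> g <- /eqP; rewrite (root_connect symR) => conn.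
by apply: imset_f; apply: (@fconnect_of_par _ _ m); rewrite par_hd symR.
Qed.

Lemma old_in_face v e : v \in face_verts e -> old m v \in face_verts (hd m e).
Proof.
case/imsetP=> e' ee' ->; rewrite -src_hd; apply: imset_f.
by apply: (@fconnect_of_par _ _ m); rewrite !par_hd.
Qed.

Lemma new_degree_le f :
  #|[set w | inc left_face right_face w f]| <= max_face_degree G - 3.
Proof.
(* [f] is an arbitrary dart of [R]; an incident [w0] guarantees that it is the root of an actual
   face. *)
have [->|[w0]] := set_0Vmem [set w | inc left_face right_face w f]; first by rewrite cards0.
rewrite inE => /inc_new_par[g _ gE]; set e := par m g in gE.
set N := [set w | _]; set O := face_verts e.
have disj : [disjoint val @: N & old m @: O].
  rewrite -setI_eq0; apply/eqP/setP=> v; rewrite !inE; apply/negP.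
  case/andP=> /imsetP[w _ ->] /imsetP[u _ wE].
  by have := valP w; rewrite wE codom_f.
have sub : (val @: N) :|: (old m @: O) \subset face_verts (hd m e).
  rewrite subUset; apply/andP; split; apply/subsetP=> _ /imsetP[x xin ->].
    by apply: new_in_face; move: xin; rewrite inE -gE.
  exact: old_in_face.
have := subset_leq_card sub; rewrite cardsU.
move: disj; rewrite -setI_eq0 => /eqP ->; rewrite cards0 subn0.
rewrite (card_imset _ val_inj) (card_imset _ (@old_inj _ _ m)).
have : 3 <= #|O| := face_degree_ge3 R3 e R_simple.
have : #|face_verts (hd m e)| <= max_face_degree G by apply: (leq_bigmax (hd m e)).
by set k := #|face_verts _|; set n := #|N|; lia.
Qed.

Lemma new_multiplicity_le f f' : f != f' ->
  #|[set w | inc left_face right_face w f && inc left_face right_face w f']| <= t_num G.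
Proof.
move=> nff'; set N := [set w | _].
have [->|[w0 w0N]] := set_0Vmem N; first by rewrite cards0.
(* Taking at each [w] the dart on the side of [f] orients all of them alike, so [edge_of_faces]
   gives equal parents and not just parents equal up to reversal. *)
have faces w : w \in N -> exists2 g, src g = val w &
    froot faceR (par m g) = f /\ froot faceR (drev (par m g)) = f'.
  rewrite inE => /andP[/inc_new_par[g gw gf] wf']; exists g => //; split=> //.
  have gN : src g \notin codom (old m) by rewrite gw; apply: (valP w).
  have [g' g'w g'f] := inc_new_par wf'; rewrite -g'f.
  have sg : src g' = src g by rewrite g'w gw.
  case: (new_par gN sg) => [pE|<- //].
  by move: nff'; rewrite -gf -g'f pE eqxx.
have [g0 _ [g0f g0f']] := faces w0 w0N.
apply: leq_trans (multiplicity_le_t_num m (par m g0)).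
rewrite -(card_imset _ val_inj); apply/subset_leq_card/subsetP=> _ /imsetP[w wN ->].
rewrite inE (valP w) /=; apply/existsP; have [g gw [gf gf']] := faces w wN.
exists g; rewrite gw eqxx /=; apply/eqP; apply: edge_of_faces => //.
  by rewrite -(root_connect symR) g0f gf.
by rewrite -(root_connect symR) g0f' gf'.
Qed.

Lemma chi_c_subdivision_le :
  chi_c G <= chi_c R + (max_face_degree G - 3 + t_num G).
Proof.
have [cR cR_lt cRP] := chi_c_coloring R.
have [cN cN_lt cNP] := vizing_multigraph left_right_neq new_degree_le new_multiplicity_le.
pose preim v := [pick u | old m u == v].
have preim_old u : preim (old m u) = Some u.
  rewrite /preim; case: pickP => [u' /eqP/(@old_inj _ _ m) -> //|/(_ u)].
  by rewrite eqxx.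
(* New colors are shifted past the old ones. The default 0 is never taken, since a vertex that is
   not new has a preimage in [R]. *)
pose c v := if insub v is Some w then chi_c R + cN w
            else if preim v is Some u then cR u else 0.
have c_new w : c (val w) = chi_c R + cN w by rewrite /c valK.
have c_old u : c (old m u) = cR u by rewrite /c insubN ?negbK ?codom_f ?preim_old.
have newP v : (exists u, v = old m u) \/ (exists w : new_vert, v = val w).
  have [/codomP[u ->]|vN] := boolP (v \in codom (old m)); first by left; exists u.
  by right; exists (exist _ v vN).
apply: (@chi_c_le _ _ c) => [v|d v1 v2].
  case: (newP v) => [[u ->]|[w ->]]; rewrite ?c_old ?c_new ?ltn_add2l //.
  by apply: leq_trans (cR_lt u) (leq_addr _ _).
have old_face u : old m u \in face_verts d -> u \in face_verts (par m d).
  case/imsetP=> g dg uE; have gE : hd m (par m g) = g by apply: hd_par; rewrite -uE codom_f.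
  have -> : u = src (par m g) by apply: (@old_inj _ _ m); rewrite -src_hd gE.
  by apply: imset_f; apply: fconnect_par.
have new_face w : val w \in face_verts d ->
    inc left_face right_face w (froot faceR (par m d)).
  case/imsetP=> g dg wE; have -> : froot faceR (par m d) = froot faceR (par m g).
    by apply/eqP; rewrite (root_connect symR); apply: fconnect_par.
  exact: face_inc.
case: (newP v1) => [[u1 ->]|[w1 ->]]; case: (newP v2) => [[u2 ->]|[w2 ->]].
- move=> /old_face f1 /old_face f2; rewrite !c_old (inj_eq (@old_inj _ _ m)).
  exact: cRP f1 f2.
- move=> _ _ _; rewrite c_old c_new; apply/eqP=> cE.
  by have := cR_lt u1; rewrite cE ltnNge leq_addr.
- move=> _ _ _; rewrite c_old c_new; apply/eqP=> cE.
  by have := cR_lt u2; rewrite -cE ltnNge leq_addr.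
- move=> /new_face f1 /new_face f2; rewrite !c_new eqn_add2l (inj_eq val_inj).
  exact: cNP f1 f2.
Qed.

End NewVertices.

Theorem corollary3 (R G : plane_graph)
    (R_simple : simple_graph R) (R_3connected : k_connected 3 R)
    (G_subdivision : subdivision R G)
    (large_face : 2 * chi_c R + 2 * t_num G <= max_face_degree G + 6) :
  chi_c G <= (3 * max_face_degree G) %/ 2.
Proof.
have [m] := subdivision_mapP G_subdivision.
have V1 : 1 < #|vert R| by case: R_3connected => /ltnW/ltnW.
have [v _] := card_gt0P (ltnW V1); have [e _] := vertex_dart v V1.
(* This makes the truncated subtraction [max_face_degree G - 3] exact, so that doubling the bound
   and applying [large_face] gives at most [3 * max_face_degree G]. *)
have face3 : 3 <= max_face_degree G.
  apply: leq_trans (face_degree_ge3 R_3connected e R_simple) _.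
  apply: leq_trans (leq_bigmax (hd m e)); rewrite /face_degree.
  rewrite -(card_imset (mem (face_verts e)) (@old_inj _ _ m)).
  by apply/subset_leq_card/subsetP=> _ /imsetP[u ue ->]; apply: old_in_face.
apply: leq_trans (chi_c_subdivision_le m R_simple R_3connected) _.
rewrite leq_divRL //; lia.
Qed.
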